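(* Let $0<\alpha<1$ and $\theta\ge0$, and let $\widetilde\Pi_n$ be the random ordered partition of $[n]$ induced by the ordered Chinese Restaurant Process with parameters $(\alpha,\theta)$, with $\mathcal{C}_n$ the composition of $n$ formed by its block sizes. Given that the left-most block of $\widetilde\Pi_n$ is of size $n_1$, the probability that it contains $1$ is $$\frac{n_1\theta}{n_1\theta+N_2\alpha}\qquad(N_2:=n-n_1).$$ Given that $\mathcal{C}_n=(n_1,\dots,n_\ell)$, for $1\le k\le\ell$ the conditional probability that $1$ falls in the $k$th block, of size $n_k$, is $$p^{(n)}_k\prod_{j=1}^{k-1}(1-p_j^{(n)})\qquad\text{for } p_j^{(n)}=\frac{n_j\theta}{n_j\theta+N_{j+1}\alpha}\ \text{ with }\ N_{j+1}:=\sum_{i=j+1}^\ell n_i.$$ In particular, if $\theta=\alpha$, then $\widetilde\Pi_n$ is exchangeable, and the size of the block containing $1$ is a size-biased pick from the composition $\mathcal{C}_n$ of block sizes.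
   Context: Ordered Chinese Restaurant Process with parameters $(\alpha,\theta)$. Customer 1 sits at table 1. Given that $n$ customers are seated at $k$ tables (numbered in order of first occupation) with $n_i$ customers at table $i$, customer $n+1$ sits at table $i\le k$ with probability $(n_i-\alpha)/(n+\theta)$ and at a new table $k+1$ with probability $(k\alpha+\theta)/(n+\theta)$. Independently of the seating process, the tables are ordered from left to right: given the order of the first $k$ tables, table $k+1$ is placed to the right of all of them with probability $\theta/(k\alpha+\theta)$ and in each of the other $k$ possible places (to the left of all tables, or between two neighbouring tables) with probability $\alpha/(k\alpha+\theta)$. $\widetilde\Pi_n$ is the ordered partition of $[n]=\{1,\dots,n\}$ whose blocks are the sets of customers among the first $n$ sitting at each occupied table, listed from left to right. When $\theta=0$, the expression $n_j\theta/(n_j\theta+N_{j+1}\alpha)$ with $N_{j+1}=0$ is read by continuity as $1$. Exchangeable: the law of the ordered partition is invariant under permutations of $[n]$. Size-biased pick: given $\mathcal{C}_n=(n_1,\dots,n_\ell)$, the block containing 1 is the $k$th with probability $n_k/n$. *)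

(* Defs.v *)
From HB Require Import structures.
From mathcomp Require Import all_boot all_order all_algebra all_fingroup.
From mathcomp Require Import all_classical all_reals all_analysis.

Set Implicit Arguments.
Unset Strict Implicit.
Unset Printing Implicit Defensive.

Import Order.TTheory GRing.Theory Num.Theory.
Local Open Scope classical_set_scope.
Local Open Scope ring_scope.

(* MathComp-Analysis.  Customers, tables and blocks are numbered from 1 in the
   mathematics.  The random variables below keep that numbering for customers
   and tables (X i is the table of customer i, for i >= 1); elements of
   [n] = {1, ..., n} are encoded by 'I_n, with i : 'I_n standing for customer
   i.+1, and the k-th block or part is the entry of index k.-1 of a sequence. *)

(* P(A | B), for P B != 0. *)
Definition cond_prob (R : realType) (d : measure_display)
    (T : measurableType d) (P : probability T R) (A B : set T) : R :=
  fine (P (A `&` B)) / fine (P B).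

(* (X_1, ..., X_n) *)
Definition seating (T : Type) (X : nat -> T -> nat) (n : nat) (w : T) :
    seq nat :=
  [seq X i w | i <- index_iota 1 n.+1].

(* (Y_2, ..., Y_k), where Y_j is the number of tables among the first j - 1
   that stand to the left of table j at the time it is placed.  It is
   equivalent to the left-to-right order of the first k tables. *)
Definition placement (T : Type) (Y : nat -> T -> nat) (k : nat) (w : T) :
    seq nat :=
  [seq Y j w | j <- index_iota 2 k.+1].

Definition num_tables (s : seq nat) : nat := size (undup s).

(* Probability that the next customer sits at table i, when s lists the tables
   of the customers already seated. *)
Definition seat_prob (R : realType) (alpha theta : R) (s : seq nat) (i : nat) :
    R :=
  let n := size s in
  let k := num_tables s in
  if (1 <= i <= k)%N then ((count_mem i s)%:R - alpha) / (n%:R + theta)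
  else if i == k.+1 then (k%:R * alpha + theta) / (n%:R + theta)
  else 0.

(* Probability that table k.+1 is placed with exactly j of the first k tables
   to its left. *)
Definition place_prob (R : realType) (alpha theta : R) (k j : nat) : R :=
  if j == k then theta / (k%:R * alpha + theta)
  else if (j < k)%N then alpha / (k%:R * alpha + theta)
  else 0.

Record ordered_CRP (R : realType) (d : measure_display) (T : measurableType d)
    (P : probability T R) (alpha theta : R) (X Y : nat -> {RV P >-> nat}) :
    Prop := OrderedCRP {
  first_seat : P [set w | X 1%N w = 1%N] = 1%E;
  next_seat : forall (n : nat) (s : seq nat) (i : nat), (1 <= n)%N ->
    P [set w | seating X n w = s] != 0%E ->
    cond_prob P [set w | X n.+1 w = i] [set w | seating X n w = s]
      = seat_prob alpha theta s i;
  next_place : forall (k : nat) (t : seq nat) (j : nat), (1 <= k)%N ->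
    P [set w | placement Y k w = t] != 0%E ->
    cond_prob P [set w | Y k.+1 w = j] [set w | placement Y k w = t]
      = place_prob alpha theta k j;
  seat_place_indep : forall (n k : nat) (A B : set (seq nat)),
    P ((seating X n @^-1` A) `&` (placement Y k @^-1` B))
      = (P (seating X n @^-1` A) * P (placement Y k @^-1` B))%E
}.

(* The first k tables from left to right, y j being the number of earlier
   tables to the left of table j (the value of y 1 is irrelevant). *)
Fixpoint table_order (y : nat -> nat) (k : nat) : seq nat :=
  if k is k'.+1 then
    let o := table_order y k' in take (y k) o ++ k :: drop (y k) o
  else [::].

Definition ordered_partition (T : Type) (X Y : nat -> T -> nat) (n : nat)
    (w : T) : seq {set 'I_n} :=
  [seq [set i : 'I_n | X i.+1 w == j]%SET
     | j <- table_order (fun k => Y k w) (num_tables (seating X n w))].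

Definition block_sizes (n : nat) (p : seq {set 'I_n}) : seq nat :=
  [seq #|B| | B : {set 'I_n} <- p].

Definition is_composition (n : nat) (c : seq nat) : bool :=
  (0%N \notin c) && (sumn c == n).

(* m theta / (m theta + N alpha), read as 1 when theta = N = 0. *)
Definition block_prob (R : realType) (alpha theta : R) (m N : nat) : R :=
  if (theta == 0) && (N == 0%N) then 1
  else m%:R * theta / (m%:R * theta + N%:R * alpha).

(* p_{j+1}, with the sum of the parts following the one of index j as N. *)
Definition part_prob (R : realType) (alpha theta : R) (c : seq nat) (j : nat) :
    R :=
  block_prob alpha theta (nth 0%N c j)
    (\sum_(j.+1 <= i < size c) nth 0%N c i)%N.

Definition exchangeable (R : realType) (d : measure_display)
    (T : measurableType d) (P : probability T R) (n : nat)
    (Pi : T -> seq {set 'I_n}) : Prop :=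
  forall (s : {perm 'I_n}) (p : seq {set 'I_n}),
    P [set w | [seq (s @: B)%SET | B : {set 'I_n} <- Pi w] = p]
      = P [set w | Pi w = p].

(* For a random ordered partition Pi of [n] and x in [n]: given the composition
   C of block sizes, the block containing x has conditional probability
   n_k / n of being the k-th. *)
Definition size_biased_pick (R : realType) (d : measure_display)
    (T : measurableType d) (P : probability T R) (n : nat)
    (Pi : T -> seq {set 'I_n}) (x : 'I_n) : Prop :=
  forall (c : seq nat) (k : nat), is_composition n c -> (k < size c)%N ->
    cond_prob P [set w | x \in nth finset.set0 (Pi w) k]
      [set w | block_sizes (Pi w) = c] = (nth 0%N c k)%:R / n%:R.

(* Main.v *)
Require Import Defs.
From HB Require Import structures.
From mathcomp Require Import all_boot all_order all_algebra all_fingroup.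
From mathcomp Require Import all_classical all_reals all_analysis.
From mathcomp Require Import zify ring.

Set Implicit Arguments.
Unset Strict Implicit.
Unset Printing Implicit Defensive.

Import Order.TTheory GRing.Theory Num.Theory.
Local Open Scope classical_set_scope.
Local Open Scope ring_scope.

(** Write the ordered partition as a word v: the letter of customer i is the
    number of blocks to the left of the one containing i.  The pair made of the
    seating and of the placements of the tables determines v, and is determined
    by it almost surely, so the law of v is obtained by multiplying the one-step
    probabilities (history_inj, packed_history, history_prob_word).  A new table
    is seated with probability (k alpha + theta) / (n + theta), and this
    numerator is the denominator of the placement probabilities: a new table
    costs theta if it comes to the right of all the others and alpha otherwise.
    It is to the right of all the others exactly when its letter is a
    left-to-right maximum of v.  Hence
      P(v) = W(c) (theta / alpha) ^ r(v),
    where W depends on the composition c of block sizes only and r(v) counts the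
    left-to-right maxima after the first letter (prob_partition).

    For theta = alpha the power is 1, so that P(v) depends on the block sizes
    only, which is exchangeability (exchangeable_partition).

    In general, set t = theta / alpha and let R_j be the sum of the parts of
    index at least j.  Among all words with c_j letters j, let the first letter
    be k.  The words that follow it are the rearrangements of a multiset, and
    the mean of t ^ r over them is
      g_(k+1) = prod_(j > k) (c_j t + R_(j+1)) / R_j :
    each letter j > k is a record exactly when its first occurrence precedes
    those of the letters above it, which has probability c_j / R_j
    independently of the other letters.  This is proved by induction on the
    length of the words, from the decomposition according to the first letter
      R_m g_m = t sum_(k >= m) c_k g_(k+1)
    (record_mean_first, sum_records).  So the first letter is k with a
    probability proportional to c_k g_(k+1), and the same identity gives
      c_m g_(m+1) = p_m sum_(k >= m) c_k g_(k+1),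
    that is, p_m is the conditional probability that the first letter is m given
    that it is at least m; the product formula follows (first_letter_prob).
    For the left-most block, p_0 depends on the composition through n_1 and n
    only, so it can be averaged over the compositions beginning with n_1. *)

(** * The word of an ordered partition *)

Lemma perm_insert (o : seq nat) y x :
  perm_eq (take y o ++ x :: drop y o) (x :: o).
Proof. by rewrite -cat1s perm_catCA /= perm_cons cat_take_drop. Qed.

Lemma index_insert (o : seq nat) y x j : (y <= size o)%N -> x \notin o ->
  j \in o -> index j (take y o ++ x :: drop y o) = bump y (index j o).
Proof.
move=> yo xo jo; have jx : (x == j) = false by apply: contraNF xo => /eqP ->.
have -> : index j o = if j \in take y o then index j (take y o)
    else (y + index j (drop y o))%N.
  by rewrite -{1}(cat_take_drop y o) index_cat size_takel.
rewrite index_cat /= jx size_takel //; case: ifP => jt; rewrite /bump.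
  have := jt; rewrite -index_mem size_takel // => lt_jy.
  by rewrite leqNgt lt_jy.
by rewrite leq_addr addnS.
Qed.

Lemma index_inserted (o : seq nat) y x : (y <= size o)%N -> x \notin o ->
  index x (take y o ++ x :: drop y o) = y.
Proof.
move=> yo xo; rewrite index_cat /= eqxx addn0 size_takel //.
by case: ifP => // /mem_take; rewrite (negPf xo).
Qed.

Lemma eq_table_order (y z : nat -> nat) k :
  (forall j, (1 < j <= k)%N -> y j = z j) -> table_order y k = table_order z k.
Proof.
elim: k => //= k IHk yz; rewrite IHk => [|j /andP[j1 jk]]; last first.
  by apply: yz; rewrite j1 leqW.
by case: k IHk yz => [|k] IHk yz //; rewrite yz ?leqnn.
Qed.

(** The list t stands for the placements [:: Y_2; ...; Y_k]: its entry of index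
    j.-2 is Y_j, hence the (size t).+1 tables. *)
Definition left_to_right (t : seq nat) : seq nat :=
  table_order (fun j => nth 0%N t j.-2) (size t).+1.

Lemma left_to_right_rcons t y : left_to_right (rcons t y) =
  take y (left_to_right t) ++ (size t).+2 :: drop y (left_to_right t).
Proof.
rewrite /left_to_right size_rcons [LHS]/= nth_rcons ltnn eqxx.
rewrite -[in RHS](@eq_table_order (fun j => nth 0%N (rcons t y) j.-2)) //.
by move=> [|[|j]] //= jt; rewrite nth_rcons (jt : (j < size t)%N).
Qed.

Lemma left_to_right_placement (T : Type) (Y : nat -> T -> nat) k w :
  (0 < k)%N ->
  table_order (fun j => Y j w) k = left_to_right (placement Y k w).
Proof.
move=> k0; have E : size (placement Y k w) = k.-1.
  by rewrite size_map size_iota; lia.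
rewrite /left_to_right E prednK //; apply: eq_table_order => j /andP[j1 jk].
have jk' : (j.-2 < k.+1 - 2)%N by lia.
rewrite (nth_map 0%N) ?size_iota // nth_iota //.
by congr (Y _ w); lia.
Qed.

Definition word (s t : seq nat) : seq nat :=
  [seq index i (left_to_right t) | i <- s].

(** All other pairs of a seating and of placements have probability 0.  The
    placement of the second table is the first entry of t, so a seating at
    (size t).+1 tables comes with a list t. *)
Inductive history : seq nat -> seq nat -> Prop :=
| HistoryFirst : history [:: 1%N] [::]
| HistoryOld s t i : history s t -> i \in s -> history (rcons s i) t
| HistoryNew s t y : history s t -> (y <= (size t).+1)%N ->
    history (rcons s (size t).+2) (rcons t y).

Lemma num_tables_rcons s i :
  num_tables (rcons s i) = ((i \notin s) + num_tables s)%N.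
Proof.
rewrite /num_tables (perm_size (perm_undup (mem_rcons s i))) /=.
by case: (i \in s).
Qed.

Lemma mem_history s t i :
  history s t -> (i \in s) = (0 < i <= (size t).+1)%N.
Proof.
move=> h; elim: h i => [|s' t' i' _ IH i's|s' t' y _ IH _] i.
- by rewrite inE eqn_leq andbC.
- by rewrite mem_rcons inE IH; case: eqP => [->|//]; rewrite -IH i's.
- by rewrite mem_rcons inE IH size_rcons; lia.
Qed.

Lemma num_tables_history s t : history s t -> num_tables s = (size t).+1.
Proof.
elim=> [//|s' t' i _ IH i's|s' t' y h IH _]; rewrite num_tables_rcons.
  by rewrite i's.
by rewrite (mem_history _ h) ltnn IH size_rcons.
Qed.

Lemma perm_left_to_right t : perm_eq (left_to_right t) (iota 1 (size t).+1).
Proof.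
elim/last_ind: t => [//|t y IH]; rewrite left_to_right_rcons.
rewrite (perm_trans (perm_insert _ _ _)) // size_rcons.
have -> : iota 1 (size t).+2 = rcons (iota 1 (size t).+1) (size t).+2.
  by rewrite -cats1 -(iotaD 1 _ 1) addn1.
by rewrite perm_sym perm_rcons perm_cons perm_sym.
Qed.

Lemma size_left_to_right t : size (left_to_right t) = (size t).+1.
Proof. by rewrite (perm_size (perm_left_to_right t)) size_iota. Qed.

Lemma mem_left_to_right t i :
  (i \in left_to_right t) = (0 < i <= (size t).+1)%N.
Proof. by rewrite (perm_mem (perm_left_to_right t)) mem_iota; lia. Qed.

Lemma history_left_to_right s t : history s t -> s =i left_to_right t.
Proof. by move=> h i; rewrite mem_left_to_right (mem_history i h). Qed.

Lemma word_rcons s i t : word (rcons s i) t =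
  rcons (word s t) (index i (left_to_right t)).
Proof. exact: map_rcons. Qed.

(** Inserting a table with y tables to its left shifts the letters from y on. *)
Lemma word_new s t y : history s t -> (y <= (size t).+1)%N ->
  word (rcons s (size t).+2) (rcons t y) =
    rcons [seq bump y x | x <- word s t] y.
Proof.
move=> h yt; have new : (size t).+2 \notin left_to_right t.
  by rewrite mem_left_to_right ltnn.
rewrite word_rcons left_to_right_rcons index_inserted ?size_left_to_right //.
congr rcons.
rewrite -map_comp; apply/eq_in_map => i.
rewrite (history_left_to_right h) /= => io.
by rewrite left_to_right_rcons index_insert ?size_left_to_right.
Qed.

Lemma mem_word s t i : history s t -> i \in left_to_right t ->
  (index i (left_to_right t) \in word s t) = (i \in s).
Proof.
move=> h io; apply/mapP/idP => [[j js E]|is_]; last by exists i.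
by rewrite (index_inj 0%N _ _ E) // -(history_left_to_right h).
Qed.

(** The last letter of the word occurs earlier exactly when the last customer
    sits at an occupied table, and a new last letter is the placement of the
    last table; so the two histories can be unwound together. *)
Lemma history_inj s t s' t' : history s t -> history s' t' ->
  word s t = word s' t' -> s = s' /\ t = t'.
Proof.
have size1 s1 t1 : history s1 t1 -> (0 < size s1)%N.
  by case=> *; rewrite ?size_rcons.
move=> h; elim: h s' t' => {s t} [|s t i h IH is_|s t y h IH yt] s' t' h'.
- case: h' => [//|s1 t1 i1 h1 _|s1 t1 y1 h1 _] /(congr1 size) /eqP;
    by rewrite !size_map size_rcons eqSS eq_sym -leqn0 leqNgt (size1 _ _ h1).
- have io : i \in left_to_right t by rewrite -(history_left_to_right h).
  case: h' => [|s1 t1 i1 h1 i1s|s1 t1 y1 h1 yt1].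
  + move/(congr1 size)/eqP; rewrite !size_map size_rcons eqSS.
    by rewrite -leqn0 leqNgt (size1 _ _ h).
  + rewrite !word_rcons => /rcons_inj[/(IH _ _ h1)[es et] E].
    by subst s1 t1; rewrite (index_inj 0%N _ _ E) // -(history_left_to_right h).
  + rewrite (word_new h1 yt1) word_rcons => /rcons_inj[E Ei].
    have := is_; rewrite -(mem_word h io) E Ei => /mapP[x _ /eqP].
    by rewrite (negPf (neq_bump _ _)).
- case: h' => [|s1 t1 i1 h1 i1s|s1 t1 y1 h1 yt1].
  + move/(congr1 size)/eqP; rewrite !size_map size_rcons eqSS.
    by rewrite -leqn0 leqNgt (size1 _ _ h).
  + have i1o : i1 \in left_to_right t1 by rewrite -(history_left_to_right h1).
    rewrite (word_new h yt) word_rcons => /rcons_inj[E Ei].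
    have := i1s; rewrite -(mem_word h1 i1o) -E -Ei => /mapP[x _ /eqP].
    by rewrite (negPf (neq_bump _ _)).
  + rewrite (word_new h yt) (word_new h1 yt1) => /rcons_inj[E Ey].
    move: E; rewrite Ey => /(inj_map (can_inj (@bumpK y1))).
    by move=> /(IH _ _ h1)[-> ->].
Qed.

(** The letters are 0, ..., l.-1 for some l: l distinct letters less than l
    exhaust this range. *)
Definition packed (v : seq nat) : bool := all (gtn (num_tables v)) v.

Lemma mem_packed v x : packed v -> (x \in v) = (x < num_tables v)%N.
Proof.
move=> /allP pv; rewrite -mem_undup.
have [||_ ->] := @uniq_min_size _ _ (iota 0 (num_tables v)) (undup_uniq v).
- by move=> y; rewrite mem_undup mem_iota => /pv.
- by rewrite size_iota.
- by rewrite mem_iota.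
Qed.

Lemma packedP v l : v =i iota 0 l -> packed v /\ num_tables v = l.
Proof.
move=> vl; have nv : num_tables v = l.
  rewrite /num_tables -[RHS](size_iota 0); apply/perm_size/uniq_perm.
  - exact: undup_uniq.
  - exact: iota_uniq.
  - by move=> x; rewrite mem_undup.
by split=> //; apply/allP => x; rewrite vl mem_iota nv.
Qed.

Lemma word_packed s t :
  history s t -> packed (word s t) /\ num_tables (word s t) = (size t).+1.
Proof.
move=> h; apply: packedP => x; rewrite mem_iota /= -size_left_to_right.
apply/mapP/idP => [[i]|xt].
  by rewrite (history_left_to_right h) -index_mem => ? ->.
exists (nth 0%N (left_to_right t) x).
  by rewrite (history_left_to_right h) mem_nth.
by rewrite index_uniq // (perm_uniq (perm_left_to_right t)) iota_uniq.
Qed.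

Lemma map_bumpK y v : y \notin v ->
  [seq bump y x | x <- [seq unbump y x | x <- v]] = v.
Proof.
move=> yv; rewrite -map_comp -[RHS]map_id; apply/eq_in_map => x xv /=.
by apply: unbumpK; apply: contraNneq yv => <-.
Qed.

(** Removing the last letter of a packed word leaves a packed word if that
    letter occurs earlier; otherwise it does so after closing the gap that it
    leaves, the letter itself being then the placement of the last table. *)
Lemma packed_history v : (0 < size v)%N -> packed v ->
  exists s t, history s t /\ word s t = v.
Proof.
move: {2}(size v) (leqnn (size v)) => n; elim: n v => [|n IH] v.
  by case: v.
case/lastP: v => // v x; rewrite size_rcons ltnS => vn _ pvx.
have memv y := mem_packed y pvx; rewrite num_tables_rcons in memv.
have [v0|v_gt0] := posnP (size v).
  move: memv; rewrite (size0nil v0) => /(_ x) /=.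
  rewrite inE eqxx => /esym; rewrite ltnS leqn0 => /eqP ->.
  by exists [:: 1%N], [::]; split; first exact: HistoryFirst.
have [xv|xv] := boolP (x \in v).
  have [|s [t [h Ev]]] := IH v vn v_gt0.
    apply: (packedP (l := num_tables v) _).1 => y.
    rewrite mem_iota /=; have := memv y; rewrite xv /= => <-.
    by rewrite mem_rcons inE; case: eqP => // ->.
  have xt : (x < size (left_to_right t))%N.
    move: xv; rewrite -Ev => /mapP[i].
    by rewrite (history_left_to_right h) -index_mem => ? ->.
  exists (rcons s (nth 0%N (left_to_right t) x)), t; split.
    by apply: HistoryOld; rewrite ?(history_left_to_right h) ?mem_nth.
  rewrite word_rcons Ev index_uniq //.
  by rewrite (perm_uniq (perm_left_to_right t)) iota_uniq.
have uv : [seq unbump x y | y <- v] =i iota 0 (num_tables v).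
  move=> y; rewrite mem_iota /= add0n; apply/mapP/idP => [[z zv ->]|yv].
    have := memv z; rewrite mem_rcons inE zv orbT xv /unbump.
    have : z != x by apply: contraNneq xv => <-.
    have := memv x; rewrite mem_rcons inE eqxx /= xv.
    lia.
  exists (bump x y); last by rewrite bumpK.
  have := memv (bump x y); rewrite mem_rcons inE eq_sym (negPf (neq_bump _ _)).
  by move=> /= ->; rewrite xv /bump; lia.
have [puv nuv] := packedP uv.
have [||s [t [h Ev]]] := IH _ _ _ puv; rewrite ?size_map //.
have nt : num_tables v = (size t).+1 by rewrite -nuv -Ev (word_packed h).2.
have xt : (x <= (size t).+1)%N.
  by have := memv x; rewrite mem_rcons inE eqxx xv nt.
exists (rcons s (size t).+2), (rcons t x); split; first exact: HistoryNew.
by rewrite word_new // Ev map_bumpK.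
Qed.

(** * Weights of words *)

(** Strict left-to-right maxima of v, when the letters read before v have
    maximum m. *)
Fixpoint records (m : nat) (v : seq nat) : nat :=
  if v is x :: u then ((m < x) + records (maxn m x) u)%N else 0%N.

Lemma records_rcons m v x :
  records m (rcons v x) = (records m v + all (gtn x) (m :: v))%N.
Proof.
elim: v m => [|y v IH] m /=; first by rewrite addn0 andbT.
by rewrite IH /= gtn_max addnA andbA.
Qed.

Lemma ltn_bump y m n : (bump y m < bump y n)%N = (m < n)%N.
Proof. by rewrite /bump; lia. Qed.

Lemma records_bump y m v :
  records (bump y m) [seq bump y x | x <- v] = records m v.
Proof.
elim: v m => //= x v IH m; rewrite ltn_bump -IH; congr (_ + records _ _)%N.
by rewrite /bump; lia.
Qed.

(** The factor of the law of a word that is invariant under rearrangement of the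
    letters.  It gives each block but the one of the first customer the factor
    alpha of a table placed to the left of another one. *)
Definition shape_weight (R : realType) (alpha theta : R) (v : seq nat) : R :=
  alpha ^+ (num_tables v).-1
    * (\prod_(x <- undup v) \prod_(1 <= i < count_mem x v) (i%:R - alpha))
    / \prod_(1 <= i < size v) (i%:R + theta).

(** The power corrects the factor alpha into theta for the tables placed to the
    right of all the others.  With the first letter as initial maximum, that
    letter is not counted. *)
Definition word_weight (R : realType) (alpha theta : R) (v : seq nat) : R :=
  shape_weight alpha theta v
    * (theta / alpha) ^+ records (head 0%N v) (behead v).

Lemma count_rcons (p : pred nat) v x :
  count p (rcons v x) = (count p v + p x)%N.
Proof. by rewrite -cats1 count_cat /= addn0. Qed.

Section WordWeight.
Variables (R : realType) (alpha theta : R).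
Hypothesis alpha_gt0 : 0 < alpha.

Lemma perm_num_tables v u : perm_eq v u -> num_tables v = num_tables u.
Proof. by move=> /perm_mem vu; apply/perm_size/perm_undup. Qed.

Lemma perm_shape_weight v u :
  perm_eq v u -> shape_weight alpha theta v = shape_weight alpha theta u.
Proof.
move=> vu; rewrite /shape_weight (perm_num_tables vu) (perm_size vu).
congr (_ * _ / _); rewrite (perm_big (undup u)) /=; last first.
  by apply/perm_undup/perm_mem.
by apply: eq_bigr => x _; rewrite (seq.permP vu).
Qed.

Lemma shape_weight_gt0 v :
  alpha < 1 -> 0 <= theta -> 0 < shape_weight alpha theta v.
Proof.
move=> alpha_lt1 theta_ge0; rewrite divr_gt0 ?mulr_gt0 ?exprn_gt0 //.
  apply: prodr_gt0 => x _; rewrite big_nat prodr_gt0 // => i /andP[i1 _].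
  by rewrite subr_gt0 (lt_le_trans alpha_lt1) // ler1n.
rewrite big_nat prodr_gt0 // => i /andP[i1 _].
by rewrite ltr_wpDr // ltr0n.
Qed.

Lemma shape_weight_old v x : x \in v ->
  shape_weight alpha theta (rcons v x) = shape_weight alpha theta v
    * (((count_mem x v)%:R - alpha) / ((size v)%:R + theta)).
Proof.
move=> xv; have v1 : (0 < size v)%N by case: v xv.
have ux : perm_eq (undup (rcons v x)) (undup v).
  by apply: perm_undup => y; rewrite mem_rcons inE; case: eqP => // ->.
have cx : (0 < count_mem x v)%N by rewrite -has_count has_pred1.
rewrite /shape_weight num_tables_rcons xv (perm_big _ ux) /= size_rcons.
rewrite [in X in _ / X]big_nat_recr //= invfM.
pose G k : R := \prod_(1 <= i < k) (i%:R - alpha).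
have -> : \prod_(y <- undup v) G (count_mem y (rcons v x)) =
    ((count_mem x v)%:R - alpha) * \prod_(y <- undup v) G (count_mem y v).
  rewrite (bigD1_seq x) ?mem_undup ?undup_uniq //=.
  rewrite [in RHS](bigD1_seq x) ?mem_undup ?undup_uniq //= count_rcons /=.
  rewrite eqxx addn1 {1}/G big_nat_recr //= mulrA [_ * G _]mulrC.
  congr (_ * _); apply: eq_bigr => y yx.
  by rewrite count_rcons /= eq_sym (negPf yx) addn0.
by rewrite /G; ring.
Qed.

Lemma shape_weight_new v y : (0 < size v)%N ->
  shape_weight alpha theta (rcons [seq bump y x | x <- v] y)
    = shape_weight alpha theta v * (alpha / ((size v)%:R + theta)).
Proof.
move=> v1; set bv := map _ v.
have bi : injective (bump y) by apply: can_inj (@bumpK y).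
have ybv : y \notin bv.
  by apply/mapP => -[x _ /eqP]; rewrite (negPf (neq_bump _ _)).
have ux : perm_eq (undup (rcons bv y)) (y :: [seq bump y x | x <- undup v]).
  rewrite -undup_map_inj // -[y :: _]undup_id.
    by apply: perm_undup => x; rewrite mem_rcons !inE mem_undup.
  by rewrite /= mem_undup ybv undup_uniq.
have nv : (0 < num_tables v)%N.
  by case: v v1 {bv ybv ux} => // z v _; rewrite -has_predT; apply/hasP;
     exists z; rewrite // mem_undup mem_head.
have nb : num_tables bv = num_tables v.
  by rewrite /num_tables undup_map_inj // size_map.
rewrite /shape_weight num_tables_rcons ybv nb (perm_big _ ux) /= size_rcons.
rewrite size_map [in X in _ / X]big_nat_recr //= invfM.
rewrite big_cons count_rcons /= eqxx (count_memPn ybv) big_geq // mul1r.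
rewrite big_map -{1}(prednK nv) exprS.
rewrite (eq_bigr (fun x => \prod_(1 <= i < count_mem x v) (i%:R - alpha))).
  by ring.
move=> x _; rewrite count_rcons /= (negPf (neq_bump _ _)) addn0 count_map.
by congr (\prod_(1 <= i < _) _); apply: eq_count => z /=; rewrite (inj_eq bi).
Qed.

(** The factor is the probability of sitting at the occupied table with letter
    x; a repeated letter is never a record. *)
Lemma word_weight_old v x : x \in v ->
  word_weight alpha theta (rcons v x) = word_weight alpha theta v
    * (((count_mem x v)%:R - alpha) / ((size v)%:R + theta)).
Proof.
move=> xv; rewrite /word_weight shape_weight_old //.
case: v xv => //= z v xzv; rewrite records_rcons.
suff -> : all (gtn x) (z :: v) = false by rewrite addn0; ring.
by apply/allP => /(_ x xzv) /=; rewrite ltnn.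
Qed.

(** The factor is the product of the probability of sitting at a new table and
    of that of placing it with y tables to its left; this is a record exactly
    when all tables are to its left. *)
Lemma word_weight_new v y : (0 < size v)%N -> packed v ->
    (y <= num_tables v)%N ->
  word_weight alpha theta (rcons [seq bump y x | x <- v] y)
    = word_weight alpha theta v
      * ((if y == num_tables v then theta else alpha) / ((size v)%:R + theta)).
Proof.
move=> v1 pv yv; rewrite /word_weight shape_weight_new //.
(* A letter from y on is shifted above y, so any such letter prevents a record;
   the letters of v being 0, ..., l.-1, there is none exactly when y = l. *)
have -> : (y == num_tables v) = all (gtn y) [seq bump y x | x <- v].
  rewrite all_map; apply/eqP/allP => [-> x|ally].
    by rewrite mem_packed //= /bump; lia.
  apply/eqP; rewrite eqn_leq yv leqNgt; apply/negP => lt_yv.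
  have /ally /= : y \in v by rewrite mem_packed.
  by rewrite /bump leqnn; lia.
case: v v1 pv yv => //= z v _ _ _; rewrite records_rcons records_bump /=.
case: ifP => _; rewrite ?addn0 ?addn1 ?exprS; last by ring.
have a0 := lt0r_neq0 alpha_gt0.
by set e := (_ + theta)^-1; field.
Qed.

End WordWeight.

(** * Records of the rearrangements of a multiset *)

Definition part_tail (c : seq nat) (m : nat) : nat :=
  \sum_(m <= i < size c) nth 0%N c i.

Lemma part_tail_rec c m : (m < size c)%N ->
  part_tail c m = (nth 0%N c m + part_tail c m.+1)%N.
Proof. by move=> mc; rewrite /part_tail big_ltn. Qed.

Lemma part_tail0 c m : (size c <= m)%N -> part_tail c m = 0%N.
Proof. by move=> cm; rewrite /part_tail big_geq. Qed.

(** The number of orderings of the positions of s, as distinguishable letters,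
    that give the same word. *)
Definition mult_fact (l : nat) (s : seq nat) : nat :=
  \prod_(0 <= y < l) (count_mem y s)`!.

Lemma count_rem_neq (s : seq nat) x y : x != y ->
  count_mem y (rem x s) = count_mem y s.
Proof. by move=> xy; rewrite count_rem /= (negPf xy) andbF subn0. Qed.

Lemma mult_fact_rem l s x : x \in s -> (x < l)%N ->
  mult_fact l s = (count_mem x s * mult_fact l (rem x s))%N.
Proof.
move=> xs xl; rewrite /mult_fact !(bigD1_seq x) ?mem_index_iota ?iota_uniq //=.
rewrite mulnA; congr (_ * _)%N; last first.
  by apply: eq_bigr => y yx; rewrite count_rem_neq // eq_sym.
rewrite count_rem xs /= eqxx subn1.
have : (0 < count_mem x s)%N by rewrite -has_count has_pred1.
by case: (count_mem x s) => // k _; rewrite factS.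
Qed.

Lemma sum_count_undup (R : nzSemiRingType) l s (F : nat -> R) :
    all (gtn l) s ->
  \sum_(x <- undup s) (count_mem x s)%:R * F x
    = \sum_(0 <= x < l) (count_mem x s)%:R * F x.
Proof.
move=> /allP sl; rewrite [RHS](bigID (mem s)) /= [X in _ + X]big1 ?addr0.
  rewrite -[RHS]big_filter; apply: perm_big.
  rewrite uniq_perm ?undup_uniq ?filter_uniq ?iota_uniq // => x.
  rewrite mem_undup mem_filter mem_index_iota /=.
  by case: (boolP (x \in s)) => // /sl.
by move=> x xs; rewrite (count_memPn xs) mul0r.
Qed.

Lemma sum_count_mem l s : all (gtn l) s ->
  (\sum_(0 <= x < l) count_mem x s)%N = size s.
Proof.
elim: s => [_|y s IH /= /andP[yl sl]]; first by rewrite big1.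
rewrite big_split /= IH // (bigD1_seq y) ?mem_index_iota ?iota_uniq //=.
rewrite eqxx big1 ?addn0 // => x; rewrite eq_sym => /negPf -> //.
Qed.

Section Records.
Variables (R : realType) (t : R) (c : seq nat).
Hypothesis c_pos : 0%N \notin c.

Lemma nth_part_gt0 k : (k < size c)%N -> (0 < nth 0%N c k)%N.
Proof. by move=> kc; rewrite lt0n (memPn c_pos) ?mem_nth. Qed.

Lemma part_tail_gt0 k : (k < size c)%N -> (0 < part_tail c k)%N.
Proof. by move=> kc; rewrite part_tail_rec // addn_gt0 nth_part_gt0. Qed.

(** The mean of t ^ records over the words that contain each letter j >= m with
    multiplicity c`_j, after a maximum less than m: a letter j is a record if it
    occurs before all the larger ones, which has probability
    c`_j / part_tail c j independently for all j. *)
Definition record_mean (m : nat) : R :=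
  \prod_(m <= j < size c)
    (((nth 0%N c j)%:R * t + (part_tail c j.+1)%:R) / (part_tail c j)%:R).

Lemma record_mean_rec m : (m < size c)%N ->
  (part_tail c m)%:R * record_mean m =
    ((nth 0%N c m)%:R * t + (part_tail c m.+1)%:R) * record_mean m.+1.
Proof.
move=> mc; rewrite /record_mean big_ltn // mulrA mulrCA divff ?mulr1 //.
by rewrite pnatr_eq0 -lt0n part_tail_gt0.
Qed.

Lemma record_mean_ge0 m : 0 <= t -> 0 <= record_mean m.
Proof.
move=> t_ge0; apply: prodr_ge0 => j _.
by rewrite divr_ge0 // addr_ge0 // mulr_ge0.
Qed.

(** The right-hand side decomposes the mean according to the first letter
    k >= m: it is a record, after which only the letters above k can be
    records. *)
Lemma record_mean_first m :
  (part_tail c m)%:R * record_mean m =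
    t * \sum_(m <= k < size c) (nth 0%N c k)%:R * record_mean k.+1.
Proof.
have [n] := ubnP (size c - m); elim: n m => // n IH m mn.
have [mc|cm] := ltnP m (size c); last first.
  by rewrite part_tail0 // mul0r big_geq ?mulr0.
rewrite record_mean_rec // mulrDl IH; last by lia.
by rewrite [in RHS]big_ltn // [RHS]mulrDr; congr (_ + _); ring.
Qed.

(** The multiset s may contain the letters up to m in any number, since they are
    never records; those above m must all be left with their full
    multiplicities.  The factorials turn the sum over distinct words into one
    over all orderings, where the first letter is x with probability
    count_mem x s / size s. *)
Lemma sum_records s m : (m < size c)%N -> all (gtn (size c)) s ->
    (forall j, (m < j)%N -> count_mem j s = nth 0%N c j) ->
  (\sum_(u <- permutations s) t ^+ records m u) * (mult_fact (size c) s)%:R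
    = (size s)`!%:R * record_mean m.+1.
Proof.
have [n] := ubnP (size s); elim: n s m => // n IH s m sn mc sc cs.
have [s0|s_nil] := posnP (size s).
  have lm : (size c <= m.+1)%N.
    rewrite leqNgt; apply/negP => /nth_part_gt0.
    by rewrite -cs // (size0nil s0).
  rewrite (size0nil s0) /= /record_mean big_geq // big_seq1 /mult_fact.
  by rewrite big1.
rewrite (perm_big _ (permutationsE s_nil)) big_allpairs_dep /= mulr_suml.
have step x : x \in undup s ->
  (\sum_(u <- permutations (rem x s)) t ^+ ((m < x) + records (maxn m x) u))
     * (mult_fact (size c) s)%:R
  = (count_mem x s)%:R
     * ((size s).-1`!%:R * (t ^+ (m < x)%N * record_mean (maxn m x).+1)).
  rewrite mem_undup => xs; have xc : (x < size c)%N by exact: (allP sc).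
  under eq_bigr => u _ do rewrite exprD.
  rewrite -mulr_sumr (mult_fact_rem xs xc) natrM.
  have := IH (rem x s) (maxn m x); rewrite size_rem // => IHx.
  rewrite mulrACA [_ * _%:R]mulrC -mulrA; congr (_ * _).
  rewrite IHx; first by rewrite mulrCA.
  - by move: sn; case: (size s) s_nil.
  - by rewrite gtn_max mc.
  - by apply/allP => y /mem_rem /(allP sc).
  - move=> j; rewrite gtn_max => /andP[mj xj].
    by rewrite count_rem_neq ?cs // ltn_eqF.
rewrite (eq_big_seq _ step) (sum_count_undup _ sc).
under eq_bigr => x _ do rewrite mulrCA.
rewrite -mulr_sumr -[in RHS](prednK s_nil) factS prednK // mulnC natrM -mulrA.
congr (_ * _); rewrite -(sum_count_mem sc).
rewrite (big_cat_nat (n := m.+1)) //= [in RHS](big_cat_nat (n := m.+1)) //=.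
rewrite natrD mulrDl; congr (_ + _).
  rewrite natr_sum mulr_suml; apply: eq_big_nat => x /andP[_ xm].
  by rewrite ltnNge -ltnS xm mul1r (maxn_idPl _).
(* A first letter above m is a record: this is the decomposition of
   record_mean_first. *)
have -> : (\sum_(m.+1 <= x < size c) count_mem x s)%N = part_tail c m.+1.
  by apply: eq_big_nat => x /andP[mx _]; rewrite cs.
rewrite record_mean_first mulr_sumr; apply: eq_big_nat => x /andP[mx _].
by rewrite mx (maxn_idPr (ltnW mx)) cs // expr1 mulrCA.
Qed.

(** Up to a factor that does not depend on m, the probability that the word has
    composition c and a first letter at least m. *)
Definition first_letter_mass m : R :=
  \sum_(m <= k < size c) (nth 0%N c k)%:R * record_mean k.+1.

Lemma first_letter_mass_rec m : (m < size c)%N ->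
  first_letter_mass m =
    (nth 0%N c m)%:R * record_mean m.+1 + first_letter_mass m.+1.
Proof. by move=> mc; rewrite /first_letter_mass big_ltn. Qed.

Lemma first_letter_mass_gt0 :
  0 <= t -> (0 < size c)%N -> 0 < first_letter_mass 0.
Proof.
(* If t = 0, only the term of the last part is positive: the first customer is
   in the right-most block. *)
move=> t_ge0 c0; rewrite /first_letter_mass -(prednK c0) big_nat_recr //=.
rewrite prednK //.
rewrite ltr_wpDl //.
  by apply: sumr_ge0 => k _; rewrite mulr_ge0 // record_mean_ge0.
rewrite {1}/record_mean big_geq // mulr1 ltr0n nth_part_gt0 //.
by rewrite prednK.
Qed.

End Records.

Lemma block_prob_ratio (R : realType) (alpha theta : R) m N :
  alpha != 0 -> block_prob alpha theta m N = block_prob 1 (theta / alpha) m N.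
Proof.
move=> a0; rewrite /block_prob mulf_eq0 invr_eq0 (negPf a0) orbF.
case: ifP => // _; rewrite mulr1 mulrA.
have -> : m%:R * theta + N%:R * alpha = (m%:R * theta / alpha + N%:R) * alpha.
  by rewrite mulrDl divfK.
by rewrite invfM mulrA mulrAC.
Qed.

(** By record_mean_first, p_j is the conditional probability of the first letter
    being j given that it is at least j. *)
Lemma first_letter_prob (R : realType) (alpha theta : R) (c : seq nat) k :
    0 < alpha -> 0 <= theta -> 0%N \notin c -> (k < size c)%N ->
  (nth 0%N c k)%:R * record_mean (theta / alpha) c k.+1 =
    part_prob alpha theta c k * \prod_(j < k) (1 - part_prob alpha theta c j)
      * first_letter_mass (theta / alpha) c 0.
Proof.
move=> a0 th0 c0; set t := theta / alpha.
have t0 : 0 <= t by rewrite divr_ge0 // ltW.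
have step j : (j < size c)%N -> (nth 0%N c j)%:R * record_mean t c j.+1 =
    part_prob alpha theta c j * first_letter_mass t c j.
  move=> jc; rewrite first_letter_mass_rec // /part_prob.
  rewrite block_prob_ratio ?gt_eqF // -/(part_tail c j.+1) -/t /block_prob.
  have [jl|jl] := ltnP j.+1 (size c).
    have T0 := part_tail_gt0 c0 jl.
    rewrite (gtn_eqF T0) andbF mulr1.
    have D0 : (nth 0%N c j)%:R * t + (part_tail c j.+1)%:R != 0.
      by rewrite gt_eqF // ltr_wpDl ?ltr0n // mulr_ge0.
    have := record_mean_first t c0 j.+1.
    rewrite -/(first_letter_mass t c j.+1) => E.
    apply: (mulfI D0); rewrite mulrDl [in LHS](mulrCA (part_tail _ _)%:R) E.
    by field.
  (* For the last part, p_j is 1, by convention if theta = 0. *)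
  rewrite /first_letter_mass big_geq // part_tail0 // eqxx andbT addr0 mul0r.
  rewrite addr0; case: eqP => [_|/eqP tn0]; first by rewrite mul1r.
  by rewrite divff ?mul1r // mulf_neq0 // pnatr_eq0 -lt0n nth_part_gt0.
move=> kc; rewrite step // -mulrA; congr (_ * _).
elim: k kc => [|k IH] kc; first by rewrite big_ord0 mul1r.
rewrite big_ord_recr /= mulrAC -IH ?(ltnW kc) // mulrBr mulr1.
rewrite [_ * part_prob _ _ _ _]mulrC -step ?(ltnW kc) //.
by rewrite (first_letter_mass_rec _ (ltnW kc)) [RHS]addrC addKr.
Qed.

(** * Random elements of a countable type *)

Section Discrete.
Variables (R : realType) (d : measure_display) (T : measurableType d)
  (P : probability T R) (C : countType) (f : T -> C).
Hypothesis measurable_fiber : forall c, measurable [set w | f w = c].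

Lemma measurable_discrete (A : set C) : measurable [set w | A (f w)].
Proof.
have -> : [set w | A (f w)] =
    \bigcup_(k in [set pickle c | c in A]) [set w | pickle (f w) = k].
  apply/seteqP; split => [w Aw|w [_ [c Ac <-]]] /=.
    by exists (pickle (f w)) => //; exists (f w).
  by move=> /(pcan_inj pickleK) ->.
apply: bigcup_measurable => _ [c _ <-].
by congr measurable: (measurable_fiber c); apply/seteqP; split => w /= =>
  [->|/(pcan_inj pickleK)].
Qed.

Lemma discrete_null (A : set C) :
  (forall c, A c -> P [set w | f w = c] = 0%E) -> P [set w | A (f w)] = 0%E.
Proof.
move=> A0; apply: measure_negligible; first exact: measurable_discrete.
have -> : [set w | A (f w)] =
    \bigcup_k [set w | A (f w) /\ pickle (f w) = k].
  by apply/seteqP; split => [w Aw|w [k _ [Aw _]] //]; exists (pickle (f w)).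
apply: negligible_bigcup => k.
have [[w0 [Aw0 fw0]]|nw] :=
  pselect (exists w, A (f w) /\ pickle (f w) = k); last first.
  apply: negligibleS (negligible_set0 _) => w Aw.
  by apply: nw; exists w.
apply: negligibleS ((negligibleP _ (measurable_fiber (f w0))).2 (A0 _ Aw0)).
by move=> w [_]; rewrite -fw0 => /(pcan_inj pickleK).
Qed.

(** An event can be changed on values of probability 0; thus the pairs that are
    not histories will be discarded. *)
Lemma discrete_ae_eq (A B : set C) :
    (forall c, P [set w | f w = c] != 0%E -> A c <-> B c) ->
  P [set w | A (f w)] = P [set w | B (f w)].
Proof.
move=> AB.
have split_off (A1 B1 : set C) :
    (forall c, P [set w | f w = c] != 0%E -> A1 c <-> B1 c) ->
    P [set w | A1 (f w)] = P [set w | A1 (f w) /\ B1 (f w)].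
  move=> AB1; rewrite (measureDI P (measurable_discrete A1)
    (measurable_discrete B1)).
  rewrite [X in (X + _)%E](_ : _ = 0%E) ?add0e //.
  apply: (@discrete_null (A1 `\` B1)) => c [A1c nB1c].
  by apply/eqP; apply: contra_notT nB1c => /AB1 <-.
rewrite (split_off _ _ AB) [RHS](split_off _ A) => [|c /AB]; last by tauto.
by congr (P _); apply/seteqP; split => w [].
Qed.

Lemma discrete_sum (A : pred C) (L : seq C) : uniq L ->
    (forall c, A c -> c \notin L -> P [set w | f w = c] = 0%E) ->
  fine (P [set w | A (f w)])
    = \sum_(c <- L | A c) fine (P [set w | f w = c]).
Proof.
elim: L A => [|c L IH] A.
  move=> _ A0; rewrite big_nil.
  suff -> : P [set w | A (f w)] = 0%E by [].
  by apply: (@discrete_null [set x | A x]) => c Ac; exact: A0.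
move=> /= /andP[cL uL] A0; pose B : pred C := fun x => A x && (x != c).
have mA (A' : pred C) := measurable_discrete [set x | A' x].
have -> : fine (P [set w | A (f w)]) = fine (P [set w | B (f w)])
    + (if A c then fine (P [set w | f w = c]) else 0).
  have E1 : [set w | A (f w)] `\` [set w | f w = c] = [set w | B (f w)].
    apply/seteqP; split => w /=; first by move=> [Aw /eqP wc]; rewrite /B Aw.
    by move=> /andP[Aw /eqP].
  have E2 : [set w | A (f w)] `&` [set w | f w = c] =
      if A c then [set w | f w = c] else set0.
    apply/seteqP; split => w /=; first by move=> [Aw <-]; rewrite Aw.
    by case: ifP => //= Ac wc; split => //; rewrite wc.
  rewrite (measureDI P (mA A) (measurable_fiber c)) fineD.
  - by rewrite E1 E2; case: ifP => //; rewrite measure0.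
  - by rewrite E1 fin_num_measure //; exact: mA.
  - by rewrite fin_num_measure //; apply: measurableI => //; exact: mA.
rewrite IH // => [|x /andP[Ax xc] xL]; last first.
  by apply: A0; rewrite // inE negb_or xc.
rewrite big_cons; have -> : \sum_(x <- L | B x) fine (P [set w | f w = x]) =
    \sum_(x <- L | A x) fine (P [set w | f w = x]).
  rewrite big_seq_cond [RHS]big_seq_cond; apply: eq_bigl => x.
  rewrite /B; case: (boolP (x \in L)) => //= xL.
  by rewrite andbC; case: eqP => // xc; rewrite xc (negPf cL) in xL.
by case: ifP => _; rewrite ?addr0 // addrC.
Qed.

End Discrete.

(** * Law of the seating and of the placements *)

Section Chain.
Variables (R : realType) (d : measure_display) (T : measurableType d)
  (P : probability T R) (alpha theta : R) (X Y : nat -> {RV P >-> nat}).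
Hypotheses (alpha_gt0 : 0 < alpha) (theta_ge0 : 0 <= theta)
  (crp : ordered_CRP alpha theta X Y).

Lemma measurable_path (Z : nat -> {RV P >-> nat}) (r s : seq nat) :
  measurable [set w | [seq Z i w | i <- r] = s].
Proof.
elim: r s => [|i r IH] [|a s] /=.
- by rewrite [X in measurable X](_ : _ = setT) //; apply/seteqP; split.
- by rewrite [X in measurable X](_ : _ = set0) //; apply/seteqP; split.
- by rewrite [X in measurable X](_ : _ = set0) //; apply/seteqP; split.
rewrite [X in measurable X](_ : _ = (Z i @^-1` [set a]) `&`
    [set w | [seq Z i w | i <- r] = s]).
  by apply: measurableI => //; exact: measurable_funPTI.
by apply/seteqP; split => w /= [-> ->].
Qed.

Lemma measurable_RV (Z : nat -> {RV P >-> nat}) i a :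
  measurable [set w | Z i w = a].
Proof. exact: (measurable_funPTI (Z i) (Y := [set a])). Qed.

(** The chain rule, also when the conditional probability is that of a null
    event, where it carries no information. *)
Lemma fine_prob_chain (E F : set T) (p : R) :
    measurable E -> measurable F -> 
    (P F != 0%E -> cond_prob P E F = p) ->
  fine (P (E `&` F)) = fine (P F) * p.
Proof.
move=> mE mF Ep; have [F0|F0] := eqVneq (P F) 0%E.
  have -> : P (E `&` F) = 0%E.
    by apply: subset_measure0 F0 => //; exact: measurableI.
  by rewrite F0 mul0r.
rewrite -(Ep F0) /cond_prob mulrC divfK //.
by rewrite fine_eq0 // fin_num_measure.
Qed.

Lemma seatingS n (w : T) :
  seating X n.+1 w = rcons (seating X n w) (X n.+1 w).
Proof.
rewrite /seating /index_iota !subSS !subn0 -[in LHS](addn1 n).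
by rewrite iotaD map_cat cats1 add1n.
Qed.

Lemma placementS k (w : T) : (0 < k)%N ->
  placement Y k.+1 w = rcons (placement Y k w) (Y k.+1 w).
Proof.
case: k => // k _; rewrite /placement /index_iota !subSS !subn0.
rewrite -[in LHS](addn1 k).
by rewrite iotaD map_cat cats1 add2n.
Qed.

Lemma prob_seating_rcons n s i : (0 < n)%N ->
  fine (P [set w | seating X n.+1 w = rcons s i]) =
  fine (P [set w | seating X n w = s]) * seat_prob alpha theta s i.
Proof.
move=> n0; rewrite -(@fine_prob_chain [set w | X n.+1 w = i]).
- congr (fine (P _)); apply/seteqP; split => w /=; rewrite seatingS.
    by move=> /rcons_inj[-> ->].
  by move=> [-> ->].
- exact: measurable_RV.
- exact: measurable_path.
- by move=> s0; rewrite (next_seat crp).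
Qed.

Lemma prob_placement_rcons k t j : (0 < k)%N ->
  fine (P [set w | placement Y k.+1 w = rcons t j]) =
  fine (P [set w | placement Y k w = t]) * place_prob alpha theta k j.
Proof.
move=> k0; rewrite -(@fine_prob_chain [set w | Y k.+1 w = j]).
- congr (fine (P _)); apply/seteqP; split => w /=; rewrite placementS //.
    by move=> /rcons_inj[-> ->].
  by move=> [-> ->].
- exact: measurable_RV.
- exact: measurable_path.
- by move=> s0; rewrite (next_place crp).
Qed.

Definition history_prob (n : nat) (s t : seq nat) : R :=
  fine (P [set w | seating X n w = s])
    * fine (P [set w | placement Y (num_tables s) w = t]).

Lemma placement1 (w : T) : placement Y 1 w = [::].
Proof. by []. Qed.

Lemma seating1 (w : T) : seating X 1 w = [:: X 1%N w].
Proof. by []. Qed.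

(** A new table contributes (k alpha + theta) / (n + theta) to the seating and
    theta / (k alpha + theta) or alpha / (k alpha + theta) to the placements,
    and the factors k alpha + theta cancel. *)
Lemma history_prob_word s t : history s t ->
  history_prob (size s) s t = word_weight alpha theta (word s t).
Proof.
rewrite /history_prob => h; elim: h => {s t} [|s t i h IH is_|s t y h IH yt].
- rewrite [X in fine (P X) * _](_ : _ = [set w | X 1%N w = 1%N]); last first.
    by apply/seteqP; split => w /=; rewrite seating1; [case|move=> ->].
  rewrite (first_seat crp) [X in _ * fine (P X)](_ : _ = setT); last first.
    by apply/seteqP; split.
  rewrite probability_setT mul1r /word_weight /shape_weight /=.
  by rewrite !expr0 big_seq1 !big_geq // invr1 !mulr1.
- have s0 : (0 < size s)%N by case: s is_ {h IH}.
  rewrite size_rcons prob_seating_rcons // num_tables_rcons is_ mulrAC IH.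
  have io : i \in left_to_right t by rewrite -(history_left_to_right h).
  rewrite word_rcons word_weight_old ?(mem_word h) //.
  rewrite size_map count_map /seat_prob (num_tables_history h).
  rewrite -(mem_history _ h) is_; congr (_ * ((_%:R - _) / _)).
  apply: eq_in_count => j js /=; apply/eqP/eqP => [->//|E].
  by rewrite (index_inj 0%N _ _ E) // -(history_left_to_right h).
- have s0 : (0 < size s)%N.
    by have := num_tables_history h; case: (s).
  have sn : ((size t).+2 \in s) = false by rewrite (mem_history _ h) ltnn.
  rewrite size_rcons prob_seating_rcons // num_tables_rcons sn /=.
  have [pw nw] := word_packed h; have nt := num_tables_history h.
  rewrite prob_placement_rcons nt // mulrACA -{1}nt IH word_new //.
  rewrite word_weight_new ?size_map // nw //; congr (_ * _).
  rewrite /seat_prob /place_prob nt -(mem_history _ h) sn eqxx ltn_neqAle yt.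
  have D0 : (size t).+1%:R * alpha + theta != 0.
    by rewrite gt_eqF // ltr_wpDr // mulr_gt0.
  by rewrite andbT; case: eqP => _ /=; rewrite mulrC mulrA divfK.
Qed.

(** By the chain rule, a path of positive probability only makes steps of
    positive probability. *)
Lemma history_prob_neq0 n s t : (0 < n)%N ->
  history_prob n s t != 0 -> history s t /\ size s = n.
Proof.
rewrite /history_prob.
case: n => // n _; elim: n s t => [|n IH] s t.
  rewrite mulf_eq0 negb_or => /andP[s0].
  have -> : s = [:: 1%N].
    apply/eqP; apply: contraNT s0 => s1; apply/eqP.
    have E : [set w | seating X 1 w = s] `<=` ~` [set w | X 1%N w = 1%N].
      by move=> w /=; rewrite seating1 => sE E; move: s1; rewrite -sE E eqxx.
    suff -> : P [set w | seating X 1 w = s] = 0%E by [].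
    have m1 := measurable_RV X 1 1.
    apply: subset_measure0 E _ => //; first exact: measurable_path.
      exact: measurableC.
    apply: eq_trans (probability_setC P m1) _.
    by rewrite (first_seat crp) subee.
  move=> t0; split=> //; suff -> : t = [::] by exact: HistoryFirst.
  apply/eqP; apply: contraNT t0 => t0; apply/eqP.
  rewrite [X in P X](_ : _ = set0) ?measure0 //.
  apply/seteqP; split => w //=; rewrite placement1 => E.
  by rewrite -E eqxx in t0.
case/lastP: s => [|s i].
  rewrite [X in fine (P X)](_ : _ = set0) ?measure0 ?mul0r ?eqxx //.
  by apply/seteqP; split => w //=; rewrite seatingS; case: seating.
rewrite prob_seating_rcons // !mulf_eq0 !negb_or -andbA => /and3P[s0 si].
rewrite num_tables_rcons; have [is_|is_] := boolP (i \in s).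
  move=> t0; have [|h sn] := IH s t; first by rewrite mulf_neq0.
  by rewrite size_rcons sn; split=> //; exact: HistoryOld.
have k0 : (0 < num_tables s)%N.
  rewrite lt0n; apply: contraNneq s0 => /size0nil us.
  rewrite [X in fine (P X)](_ : _ = set0) ?measure0 //.
  apply/seteqP; split => w //= sE.
  have : X 1%N w \in undup s by rewrite mem_undup -sE mem_head.
  by rewrite us.
case/lastP: t => [|t y].
  rewrite [X in fine (P X)](_ : _ = set0) ?measure0 ?eqxx //.
  by apply/seteqP; split => w //=; rewrite placementS //; case: placement.
rewrite prob_placement_rcons // mulf_eq0 negb_or => /andP[t0 ty].
have [|h sn] := IH s t; first by rewrite mulf_neq0.
rewrite size_rcons sn; split => //.
move: si ty; rewrite /seat_prob /place_prob (num_tables_history h).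
rewrite -(mem_history _ h) (negPf is_).
case: (i =P (size t).+2) => [->|_]; last by rewrite eqxx.
move=> _ ty; apply: HistoryNew => //; rewrite leqNgt; apply: contraNN ty => ty.
by rewrite gtn_eqF // ltnNge (ltnW ty).
Qed.

End Chain.

(** * Law of the ordered partition *)

Definition blocks (n : nat) (v : seq nat) : seq {set 'I_n} :=
  [seq [set i : 'I_n | nth 0%N v i == x]%SET | x <- iota 0 (num_tables v)].

Lemma history_blocks n s t : history s t -> size s = n ->
  [seq [set i : 'I_n | nth 0%N s i == j]%SET | j <- left_to_right t]
    = blocks n (word s t).
Proof.
move=> h sn; rewrite /blocks (word_packed h).2 -size_left_to_right.
rewrite -{1}(mkseq_nth 0%N (left_to_right t)) /mkseq -map_comp.
apply/eq_in_map => x; rewrite mem_iota /= => xt; apply/setP => i; rewrite !inE.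
have si : (i < size s)%N by rewrite sn.
rewrite (nth_map 0%N) //.
have io : nth 0%N s i \in left_to_right t.
  by rewrite -(history_left_to_right h) mem_nth.
apply/eqP/eqP => [->|<-]; last by rewrite nth_index.
by rewrite index_uniq // (perm_uniq (perm_left_to_right t)) iota_uniq.
Qed.

Definition letters (n : nat) (v : n.-tuple 'I_n) : seq nat :=
  [seq val x | x <- v].

Lemma letters_inj n : injective (@letters n).
Proof. by move=> u v /(inj_map val_inj) /val_inj. Qed.

Lemma packed_letters n v : packed v -> size v = n ->
  exists u : n.-tuple 'I_n, letters u = v.
Proof.
move=> /allP pv vn.
have lt_n (i : 'I_n) : (nth 0%N v i < n)%N.
  have iv : (i < size v)%N by rewrite vn.
  by rewrite (leq_trans (pv _ (mem_nth _ iv))) // -vn size_undup.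
exists [tuple Ordinal (lt_n i) | i < n].
apply: (@eq_from_nth _ 0%N) => [|i]; rewrite size_map size_tuple // => iv.
rewrite -[i]/(val (Ordinal iv)) (nth_map (Ordinal iv)) ?size_tuple //.
by rewrite -tnth_nth tnth_mktuple.
Qed.

Section PartitionLaw.
Variables (R : realType) (d : measure_display) (T : measurableType d)
  (P : probability T R) (alpha theta : R) (X Y : nat -> {RV P >-> nat}).
Hypotheses (alpha_gt0 : 0 < alpha) (theta_ge0 : 0 <= theta)
  (crp : ordered_CRP alpha theta X Y).
Variable n : nat.
Hypothesis n_gt0 : (0 < n)%N.

Let run (w : T) : seq nat * seq nat :=
  (seating X n w, placement Y (num_tables (seating X n w)) w).

Let measurable_run c : measurable [set w | run w = c].
Proof.
case: c => s t; rewrite [X in measurable X](_ : _ =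
    [set w | seating X n w = s] `&` [set w | placement Y (num_tables s) w = t]).
  by apply: measurableI; exact: measurable_path.
by apply/seteqP; split => w /= => [[<- <-]|[<- <-]].
Qed.

Let prob_run s t :
  fine (P [set w | run w = (s, t)]) = history_prob X Y n s t.
Proof.
rewrite [X in P X](_ : _ = (seating X n @^-1` [set s])
    `&` (placement Y (num_tables s) @^-1` [set t])); last first.
  by apply/seteqP; split => w /= => [[<- <-]|[<- <-]].
rewrite (seat_place_indep crp) fineM // fin_num_measure //;
  exact: measurable_path.
Qed.

Let run_history s t :
  P [set w | run w = (s, t)] != 0%E -> history s t /\ size s = n.
Proof.
move=> st0; apply: (history_prob_neq0 crp n_gt0).
by rewrite -prob_run fine_eq0 // fin_num_measure.
Qed.

Lemma ordered_partition_run w : ordered_partition X Y n w =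
  [seq [set i : 'I_n | nth 0%N (run w).1 i == j]%SET
     | j <- left_to_right (run w).2].
Proof.
rewrite /ordered_partition (left_to_right_placement (fun k => Y k)); last first.
  rewrite lt0n; apply/negP => /eqP /size0nil us.
  have : X 1%N w \in undup (seating X n w).
    by rewrite mem_undup; apply: map_f; rewrite mem_index_iota /= ltnS.
  by rewrite us.
apply: eq_map => j; apply/setP => i; rewrite !inE /=.
rewrite (nth_map 0%N) ?size_iota ?subSS ?subn0 //.
by rewrite nth_iota ?subSS ?subn0.
Qed.

Lemma measurable_partition (A : pred (seq {set 'I_n})) :
  measurable [set w | A (ordered_partition X Y n w)].
Proof.
have := measurable_discrete measurable_run
  [set c | A [seq [set i : 'I_n | nth 0%N c.1 i == j]%SET
                | j <- left_to_right c.2]].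
by congr measurable; apply/seteqP; split => w /=; rewrite ordered_partition_run.
Qed.

(** The words with letters in 'I_n form a finite type that contains all packed
    words of size n, to which every event is reduced here. *)
Lemma prob_partition (A : pred (seq {set 'I_n})) :
  fine (P [set w | A (ordered_partition X Y n w)]) =
    \sum_(v : n.-tuple 'I_n | packed (letters v) && A (blocks n (letters v)))
       word_weight alpha theta (letters v).
Proof.
pose V w := word (run w).1 (run w).2.
have mV v : measurable [set w | V w = v].
  exact: (measurable_discrete measurable_run [set c | word c.1 c.2 = v]).
have V0 v : ~~ (packed v && (size v == n)) -> P [set w | V w = v] = 0%E.
  move=> nv; apply: (discrete_null measurable_run
    (A := [set c | word c.1 c.2 = v])) => -[s t] /= stv.
  apply/eqP; apply: contraNT nv => /run_history[h sn].
  by rewrite -stv (word_packed h).1 size_map sn eqxx.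
have VE v : packed v -> size v = n ->
    fine (P [set w | V w = v]) = word_weight alpha theta v.
  move=> pv vn; have v0 : (0 < size v)%N by rewrite vn.
  have [s [t [h stv]]] := packed_history v0 pv.
  have sn : size s = n by rewrite -vn -stv size_map.
  rewrite -stv -(history_prob_word alpha_gt0 theta_ge0 crp h) sn -prob_run.
  congr fine; apply: (discrete_ae_eq measurable_run
    (A := [set c | word c.1 c.2 = word s t]) (B := [set (s, t)])) => -[s' t'].
  move=> /run_history[h' _] /=; split=> [|[-> ->] //].
  by move=> /(history_inj h' h)[-> ->].
have -> : P [set w | A (ordered_partition X Y n w)]
    = P [set w | A (blocks n (V w))].
  under eq_set do rewrite ordered_partition_run.
  apply: (discrete_ae_eq measurable_run
    (A := [set c | A [seq [set i : 'I_n | nth 0%N c.1 i == j]%SET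
                | j <- left_to_right c.2]])
    (B := [set c | A (blocks n (word c.1 c.2))])) => -[s t] /=.
  by move=> /run_history[h sn]; rewrite (history_blocks h sn).
rewrite (discrete_sum mV (A := fun v => A (blocks n v))
  (L := [seq letters v | v <- enum {: n.-tuple 'I_n}])).
- rewrite big_map big_enum_cond /= big_mkcondl; apply: eq_bigr => v _.
  have ln : size (letters v) = n by rewrite size_map size_tuple.
  case: ifP => pv; first by rewrite VE.
  by rewrite V0 // pv.
- by rewrite map_inj_uniq ?enum_uniq //; exact: letters_inj.
- move=> v _ vL; apply: V0; apply: contraNN vL => /andP[pv /eqP vn].
  by have [u <-] := packed_letters pv vn; rewrite map_f // mem_enum.
Qed.

End PartitionLaw.

(** * Words with a given composition *)

Lemma block_sizes_blocks n v : size v = n ->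
  block_sizes (blocks n v) = [seq count_mem x v | x <- iota 0 (num_tables v)].
Proof.
move=> vn; rewrite /block_sizes -map_comp; apply: eq_map => x /=.
rewrite cardsE cardE /enum_mem size_filter -enumT.
rewrite -[in RHS](mkseq_nth 0%N v) vn /mkseq -val_enum_ord !count_map.
exact: eq_count.
Qed.

(** A representative of the multiset of letters of the words with composition
    c. *)
Definition sorted_word (c : seq nat) : seq nat :=
  flatten [seq nseq (nth 0%N c j) j | j <- iota 0 (size c)].

Lemma count_sorted_word c x : count_mem x (sorted_word c) = nth 0%N c x.
Proof.
rewrite /sorted_word count_flatten sumnE !big_map.
under eq_bigr => j _ do rewrite count_nseq /=.
have [xc|cx] := ltnP x (size c).
  rewrite (bigD1_seq x) ?iota_uniq ?mem_iota //= eqxx mul1n big1 ?addn0 //.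
  by move=> j /negPf ->.
rewrite nth_default // big_seq big1 // => j; rewrite mem_iota => jc.
by rewrite ltn_eqF //; lia.
Qed.

Lemma mem_sorted_word c : 0%N \notin c -> sorted_word c =i iota 0 (size c).
Proof.
move=> c0 x; rewrite mem_iota /= -has_pred1 has_count count_sorted_word.
have [xc|cx] := ltnP x (size c); first exact: nth_part_gt0.
by rewrite nth_default.
Qed.

Lemma size_sorted_word c : size (sorted_word c) = sumn c.
Proof.
rewrite /sorted_word size_flatten /shape -map_comp sumnE big_map.
rewrite [RHS]sumnE -[in RHS](mkseq_nth 0%N c) big_map.
by apply: eq_bigr => j _; rewrite /= size_nseq.
Qed.

Lemma part_tail_sumn c : part_tail c 0 = sumn c.
Proof. by rewrite /part_tail sumnE [RHS](big_nth 0%N). Qed.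

Lemma perm_sorted_word c v : 0%N \notin c ->
  perm_eq v (sorted_word c) =
    packed v && ([seq count_mem x v | x <- iota 0 (num_tables v)] == c).
Proof.
move=> c0; apply/idP/andP => [vc|[pv /eqP vc]].
  have vi : v =i iota 0 (size c).
    by move=> x; rewrite (perm_mem vc) mem_sorted_word.
  have [pv nv] := packedP vi; split => //; apply/eqP.
  rewrite nv -[RHS](mkseq_nth 0%N); apply: eq_map => x.
  by rewrite (seq.permP vc) count_sorted_word.
apply/allP => x _ /=; rewrite count_sorted_word -vc; apply/eqP.
have [xv|vx] := ltnP x (num_tables v).
  by rewrite (nth_map 0%N) ?size_iota // nth_iota //.
rewrite nth_default ?size_map ?size_iota //; apply/count_memPn.
by rewrite mem_packed // -leqNgt.
Qed.

Lemma sum_composition (R : nmodType) n c (Q : pred (seq nat))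
    (F : seq nat -> R) : is_composition n c ->
  \sum_(v : n.-tuple 'I_n | [&& packed (letters v),
      block_sizes (blocks n (letters v)) == c & Q (letters v)]) F (letters v)
  = \sum_(v <- permutations (sorted_word c) | Q v) F v.
Proof.
move=> /andP[c0 /eqP cn].
transitivity (\sum_(v <- [seq letters v | v <- enum {: n.-tuple 'I_n}]
    | perm_eq v (sorted_word c) && Q v) F v).
  rewrite big_map big_enum_cond /=; apply: eq_bigl => v.
  rewrite perm_sorted_word // block_sizes_blocks ?andbA //.
  by rewrite size_map size_tuple.
rewrite -big_filter_cond; apply: perm_big; apply: uniq_perm.
- by rewrite filter_uniq // map_inj_uniq ?enum_uniq //; exact: letters_inj.
- exact: permutations_uniq.
move=> v; rewrite mem_filter mem_permutations.
case: (boolP (perm_eq _ _)) => //= vc.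
have vn : size v = n by rewrite (perm_size vc) size_sorted_word.
have pv : packed v by move: vc; rewrite perm_sorted_word // => /andP[].
by have [u <-] := packed_letters pv vn; rewrite map_f // mem_enum.
Qed.

Section Compositions.
Variables (R : realType) (alpha theta : R) (n : nat) (c : seq nat).
Hypotheses (alpha_gt0 : 0 < alpha) (alpha_lt1 : alpha < 1)
  (theta_ge0 : 0 <= theta) (cn : is_composition n c) (n_gt0 : (0 < n)%N).

Let c0 : 0%N \notin c. Proof. by case/andP: cn. Qed.
Let sumc : sumn c = n. Proof. by case/andP: cn => _ /eqP. Qed.

(** The weight of a word without its power of theta / alpha, times the number of
    words with composition c, divided by n. *)
Definition composition_weight : R :=
  shape_weight alpha theta (sorted_word c) * (n.-1)`!%:R
    / (mult_fact (size c) (sorted_word c))%:R.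

Lemma mult_fact_gt0 l s : (0 < mult_fact l s)%N.
Proof. by rewrite prodn_gt0 // => i; exact: fact_gt0. Qed.

Lemma composition_weight_gt0 : 0 < composition_weight.
Proof.
have s0 := shape_weight_gt0 alpha_gt0 (sorted_word c) alpha_lt1 theta_ge0.
apply: divr_gt0; last by rewrite ltr0n mult_fact_gt0.
by apply: mulr_gt0 => //; rewrite ltr0n fact_gt0.
Qed.

Lemma size_composition_gt0 : (0 < size c)%N.
Proof. by move: sumc n_gt0; case: (c) => [<-|]. Qed.

(** After the first letter k, the letters above k keep their multiplicities, as
    sum_records requires. *)
Lemma sum_words_first k : (k < size c)%N ->
  \sum_(v <- permutations (sorted_word c) | head 0%N v == k)
     word_weight alpha theta v
  = composition_weight
      * ((nth 0%N c k)%:R * record_mean (theta / alpha) c k.+1).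
Proof.
move=> kc; set s := sorted_word c; set t := theta / alpha.
have ks : k \in s by rewrite mem_sorted_word // mem_iota.
have sn : size s = n by rewrite size_sorted_word.
have sc : all (gtn (size c)) s.
  by apply/allP => x; rewrite mem_sorted_word // mem_iota.
transitivity (\sum_(v <- permutations s | head 0%N v == k)
    shape_weight alpha theta s * t ^+ records (head 0%N v) (behead v)).
  rewrite big_seq_cond [RHS]big_seq_cond; apply: eq_bigr => v /andP[vs _].
  by rewrite /word_weight (perm_shape_weight _ _ (_ : perm_eq v s)) //
    -mem_permutations.
rewrite /composition_weight -/s; move: (shape_weight _ _ _) => W.
rewrite -mulr_sumr -!mulrA; congr (_ * _).
rewrite (perm_big _ (permutationsE _)) ?sn // big_mkcond big_allpairs_dep /=.
rewrite (bigD1_seq k) ?mem_undup ?undup_uniq //= [X in _ + X]big1 ?addr0.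
  rewrite eqxx; have mf0 : (mult_fact (size c) s)%:R != 0 :> R.
    by rewrite pnatr_eq0 -lt0n mult_fact_gt0.
  apply: (mulIf mf0); transitivity
    ((n.-1)`!%:R * ((nth 0%N c k)%:R * record_mean t c k.+1)); last by field.
  rewrite (mult_fact_rem ks kc) natrM mulrCA.
  rewrite (@sum_records _ t c c0 (rem k s) k) //.
  - by rewrite size_rem // sn count_sorted_word mulrCA.
  - by apply/allP => x /mem_rem /(allP sc).
  - by move=> j kj; rewrite count_rem_neq ?ltn_eqF // count_sorted_word.
by move=> x /negPf ->; rewrite big1.
Qed.

Lemma sum_words :
  \sum_(v <- permutations (sorted_word c)) word_weight alpha theta v
  = composition_weight * first_letter_mass (theta / alpha) c 0.
Proof.
rewrite /first_letter_mass mulr_sumr.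
under [RHS]eq_big_nat => k /andP[_ kc] do rewrite -sum_words_first //.
under [RHS]eq_bigr => k _ do rewrite big_mkcond.
rewrite exchange_big /=; apply: eq_big_seq => v.
rewrite mem_permutations => vc.
have hv : (head 0%N v < size c)%N.
  have : head 0%N v \in v.
    rewrite -nth0 mem_nth // (perm_size vc) size_sorted_word sumc //.
  by rewrite (perm_mem vc) mem_sorted_word // mem_iota.
rewrite (bigD1_seq (head 0%N v)) ?mem_index_iota ?iota_uniq //= eqxx.
by rewrite big1 ?addr0 // => x; rewrite eq_sym => /negPf ->.
Qed.

End Compositions.

(** * The block of the first customer *)

(** Conditioning on the value of f. *)
Lemma sum_fibers_eq0 (R : nmodType) (I : finType) (C : eqType) (f : I -> C)
    (Q : pred I) (G : I -> R) :
    (forall j, Q j -> \sum_(i | Q i && (f i == f j)) G i = 0) ->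
  \sum_(i | Q i) G i = 0.
Proof.
move=> fib0; pose L := undup [seq f i | i <- enum Q].
transitivity (\sum_(i | Q i) \sum_(x <- L | f i == x) G i).
  apply: eq_bigr => i Qi.
  rewrite big_mkcond (bigD1_seq (f i)) ?undup_uniq //= ?eqxx.
    by rewrite big1 ?addr0 // => x; rewrite eq_sym => /negPf ->.
  by rewrite mem_undup map_f // mem_enum.
rewrite (exchange_big_dep predT) //= big_seq big1 // => x.
by rewrite mem_undup => /mapP[j]; rewrite mem_enum => Qj ->; exact: fib0.
Qed.

(** Here p_j = c`_j / part_tail c j, hence
    1 - p_j = part_tail c j.+1 / part_tail c j, and the product telescopes. *)
Lemma prod_size_biased (R : realType) (alpha : R) (c : seq nat) k :
    alpha != 0 -> 0%N \notin c -> (k < size c)%N ->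
  part_prob alpha alpha c k * \prod_(j < k) (1 - part_prob alpha alpha c j)
    = (nth 0%N c k)%:R / (sumn c)%:R.
Proof.
move=> a0 c0; rewrite -part_tail_sumn.
have T0 j : (j < size c)%N -> (part_tail c j)%:R != 0 :> R.
  by move=> jc; rewrite pnatr_eq0 -lt0n part_tail_gt0.
have pE j : (j < size c)%N ->
    part_prob alpha alpha c j = (nth 0%N c j)%:R / (part_tail c j)%:R.
  move=> jc; rewrite /part_prob -/(part_tail c j.+1) /block_prob (negPf a0) /=.
  by rewrite -mulrDl -natrD -part_tail_rec // -mulf_div divff // mulr1.
elim: k => [|k IH] kc; first by rewrite big_ord0 mulr1 pE.
have kc' := ltnW kc; have := IH kc'; rewrite !pE // => IHk.
rewrite big_ord_recr /= pE //.
have c_k : (nth 0%N c k)%:R != 0 :> R by rewrite pnatr_eq0 -lt0n nth_part_gt0.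
have -> : \prod_(j < k) (1 - part_prob alpha alpha c j)
    = (part_tail c k)%:R / (part_tail c 0)%:R.
  apply: (mulfI (_ : (nth 0%N c k)%:R / (part_tail c k)%:R != 0)).
    by rewrite mulf_neq0 ?invr_eq0 ?T0.
  by rewrite IHk mulrA divfK ?T0.
have E : (part_tail c k)%:R = (nth 0%N c k)%:R + (part_tail c k.+1)%:R :> R.
  by rewrite -natrD -part_tail_rec.
have := T0 _ kc; have := T0 _ kc'; have := T0 0%N (leq_ltn_trans (leq0n _) kc).
move: E; set a := (part_tail c k)%:R; set b := (part_tail c k.+1)%:R => E.
move=> h0 ha hb; have {E} -> : (nth 0%N c k)%:R = a - b by rewrite E addrK.
by field; rewrite ha hb h0.
Qed.

Lemma packed_composition n v : size v = n -> packed v ->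
  is_composition n (block_sizes (blocks n v)).
Proof.
move=> vn pv; rewrite block_sizes_blocks //; apply/andP; split.
  apply/negP => /mapP[x]; rewrite mem_iota add0n /= -(mem_packed x pv) => xv.
  by move=> /esym /count_memPn; rewrite xv.
by rewrite sumnE big_map -{1}(subn0 (num_tables v)) sum_count_mem // vn.
Qed.

Section BlockOfOne.
Variables (R : realType) (d : measure_display) (T : measurableType d)
  (P : probability T R) (alpha theta : R) (X Y : nat -> {RV P >-> nat}).
Hypotheses (alpha_gt0 : 0 < alpha) (alpha_lt1 : alpha < 1)
  (theta_ge0 : 0 <= theta) (crp : ordered_CRP alpha theta X Y).
Variables (n : nat) (n_gt0 : (0 < n)%N).

Let Pi := ordered_partition X Y n.
Let one : 'I_n := Ordinal n_gt0.

Lemma prob_composition c : is_composition n c ->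
  fine (P [set w | block_sizes (Pi w) == c]) =
    composition_weight alpha theta n c
      * first_letter_mass (theta / alpha) c 0.
Proof.
move=> cn; rewrite (prob_partition alpha_gt0 theta_ge0 crp n_gt0
  (fun p => block_sizes p == c)) -sum_words //.
rewrite -(sum_composition predT (word_weight alpha theta) cn).
by apply: eq_bigl => v; rewrite andbT.
Qed.

Lemma prob_composition_first c k : is_composition n c -> (k < size c)%N ->
  fine (P [set w | (one \in nth finset.set0 (Pi w) k)
      && (block_sizes (Pi w) == c)]) =
    composition_weight alpha theta n c
      * ((nth 0%N c k)%:R * record_mean (theta / alpha) c k.+1).
Proof.
move=> cn kc; rewrite (prob_partition alpha_gt0 theta_ge0 crp n_gt0
  (fun p => (one \in nth finset.set0 p k) && (block_sizes p == c))).
rewrite -sum_words_first // -(sum_composition _ (word_weight alpha theta) cn).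
apply: eq_bigl => v; congr (_ && _); rewrite andbC.
case: eqP => //= vc; have kv : (k < num_tables (letters v))%N.
  by move: kc; rewrite -vc !size_map size_iota.
by rewrite /blocks (nth_map 0%N) ?size_iota // inE nth0 nth_iota.
Qed.

Lemma prob_composition_gt0 c : is_composition n c ->
  0 < fine (P [set w | block_sizes (Pi w) == c]).
Proof.
move=> cn; have [c0 _] := andP cn; rewrite prob_composition // mulr_gt0 //.
  exact: composition_weight_gt0.
apply: first_letter_mass_gt0; rewrite ?divr_ge0 ?(ltW alpha_gt0) //.
exact: size_composition_gt0 cn n_gt0.
Qed.

Lemma prob_composition_block c k : is_composition n c -> (k < size c)%N ->
  fine (P [set w | (one \in nth finset.set0 (Pi w) k)
      && (block_sizes (Pi w) == c)]) =
    part_prob alpha theta c k * \prod_(j < k) (1 - part_prob alpha theta c j)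
      * fine (P [set w | block_sizes (Pi w) == c]).
Proof.
move=> cn kc; have [c0 _] := andP cn.
rewrite prob_composition_first // prob_composition // [RHS]mulrCA.
by rewrite first_letter_prob.
Qed.

Lemma cond_prob_block c k : is_composition n c -> (k < size c)%N ->
  cond_prob P [set w | one \in nth finset.set0 (Pi w) k]
    [set w | block_sizes (Pi w) = c]
  = part_prob alpha theta c k
      * \prod_(j < k) (1 - part_prob alpha theta c j).
Proof.
move=> cn kc; rewrite /cond_prob.
have -> : [set w | block_sizes (Pi w) = c] = [set w | block_sizes (Pi w) == c].
  by apply/seteqP; split => w /= /eqP.
rewrite [X in fine (P X) / _](_ : _ = [set w |
    (one \in nth finset.set0 (Pi w) k) && (block_sizes (Pi w) == c)]).
  by rewrite prob_composition_block // mulfK // gt_eqF // prob_composition_gt0.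
by apply/seteqP; split => w /= => [[-> ->]|/andP[]].
Qed.

(** The conditional probability p_0 given the composition c is the same for all
    c beginning with n1. *)
Lemma prob_leftmost n1 : (0 < n1 <= n)%N ->
  fine (P [set w | (one \in nth finset.set0 (Pi w) 0)
      && (#|nth finset.set0 (Pi w) 0| == n1)]) =
    block_prob alpha theta n1 (n - n1)
      * fine (P [set w | #|nth finset.set0 (Pi w) 0| == n1]).
Proof.
move=> /andP[n1_gt0 n1n].
have law (A : pred (seq {set 'I_n})) : fine (P [set w | A (Pi w)]) = _ :=
  prob_partition alpha_gt0 theta_ge0 crp n_gt0 A.
pose E (p : seq {set 'I_n}) := one \in nth finset.set0 p 0.
pose F (p : seq {set 'I_n}) := #|nth finset.set0 p 0| == n1.
pose b := block_prob alpha theta n1 (n - n1).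
rewrite (law (fun p => E p && F p)) (law F) mulr_sumr.
under eq_bigl => v do rewrite [E _ && _]andbC andbA.
rewrite big_mkcondr -/b; apply/eqP; rewrite -subr_eq0 -sumrB; apply/eqP.
apply: (sum_fibers_eq0 (f := fun v => block_sizes (blocks n (letters v)))).
move=> u /andP[pu Fu]; set c := block_sizes _.
have un : size (letters u) = n by rewrite size_map size_tuple.
have cn : is_composition n c by exact: packed_composition.
have nth0E p : nth 0%N (block_sizes p) 0 = #|nth (@finset.set0 'I_n) p 0|.
  by case: p => //=; rewrite cards0.
have c_0 : nth 0%N c 0 = n1 by rewrite nth0E; exact/eqP.
have c_size : (0 < size c)%N.
  by rewrite lt0n; apply: contraTneq n1_gt0 => /size0nil c0; rewrite -c_0 c0.
have bE : b = part_prob alpha theta c 0.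
  rewrite /b /part_prob c_0 -/(part_tail c 1); congr block_prob.
  have [_ /eqP <-] := andP cn.
  by rewrite -part_tail_sumn part_tail_rec // c_0 addKn.
have := prob_composition_block cn c_size.
rewrite big_ord0 mulr1 -bE (law (fun p => E p && (block_sizes p == c))).
rewrite (law (fun p => block_sizes p == c)) mulr_sumr => fib.
have Fc v : block_sizes (blocks n (letters v)) == c -> F (blocks n (letters v)).
  by move=> /eqP vc; rewrite /F -nth0E vc c_0.
rewrite sumrB -big_mkcondr; apply/eqP; rewrite subr_eq0; apply/eqP.
rewrite -[RHS](etrans fib); last first.
  apply: eq_bigl => v; case: eqP => [/eqP /Fc ->|]; rewrite ?andbT ?andbF //.
apply: eq_bigl => v; case: eqP => [/eqP /Fc ->|]; rewrite ?andbT ?andbF //.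
Qed.

Lemma prob_leftmost_gt0 n1 : (0 < n1 <= n)%N ->
  0 < fine (P [set w | #|nth finset.set0 (Pi w) 0| == n1]).
Proof.
move=> /andP[n1_gt0 n1n].
pose c := if n1 == n then [:: n] else [:: n1; (n - n1)%N].
have cn : is_composition n c.
  rewrite /c /is_composition; case: eqP => [_|/eqP nn].
    by rewrite /= addn0 eqxx andbT mem_seq1 (eq_sym 0%N) -lt0n.
  rewrite /= addn0 subnKC // eqxx andbT !inE negb_or.
  by rewrite 2!(eq_sym 0%N) -!lt0n n1_gt0 subn_gt0 ltn_neqAle nn.
apply: lt_le_trans (prob_composition_gt0 cn) _.
have mPi (A : pred (seq {set 'I_n})) : measurable [set w | A (Pi w)] :=
  measurable_partition X Y n_gt0 A.
have m1 := mPi (fun p => block_sizes p == c).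
have m2 := mPi (fun p => #|nth finset.set0 p 0| == n1).
rewrite fine_le ?fin_num_measure // le_measure ?inE // => w /=.
case: (Pi w) => [|B p] /eqP; rewrite /c; case: eqP => //= [->|_] [-> _] //.
Qed.

Lemma cond_prob_leftmost n1 : (0 < n1 <= n)%N ->
  cond_prob P [set w | one \in nth finset.set0 (Pi w) 0]
    [set w | #|nth finset.set0 (Pi w) 0| = n1]
  = block_prob alpha theta n1 (n - n1).
Proof.
move=> n1n; rewrite /cond_prob.
have -> : [set w | #|nth finset.set0 (Pi w) 0| = n1] =
    [set w | #|nth finset.set0 (Pi w) 0| == n1].
  by apply/seteqP; split => w /= /eqP.
rewrite [X in fine (P X) / _](_ : _ = [set w |
    (one \in nth finset.set0 (Pi w) 0)
      && (#|nth finset.set0 (Pi w) 0| == n1)]).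
  by rewrite prob_leftmost // mulfK // gt_eqF // prob_leftmost_gt0.
by apply/seteqP; split => w /= => [[-> ->]|/andP[]].
Qed.

End BlockOfOne.

(** When theta = alpha, the weight of a word is invariant under rearrangement,
    and permuting customers permutes the positions of the letters. *)
Lemma exchangeable_partition (R : realType) (d : measure_display)
    (T : measurableType d) (P : probability T R) (alpha : R)
    (X Y : nat -> {RV P >-> nat}) (n : nat) : (0 < n)%N ->
    0 < alpha -> ordered_CRP alpha alpha X Y ->
  exchangeable P (ordered_partition X Y n).
Proof.
move=> n_gt0 a0 crp s p; set Pi := ordered_partition X Y n.
have law (A : pred (seq {set 'I_n})) : fine (P [set w | A (Pi w)]) = _ :=
  prob_partition a0 (ltW a0) crp n_gt0 A.
have mPi (A : pred (seq {set 'I_n})) : measurable [set w | A (Pi w)] :=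
  measurable_partition X Y n_gt0 A.
pose A1 q := [seq (s @: B)%SET | B : {set 'I_n} <- q] == p.
have E1 : [set w | [seq (s @: B)%SET | B : {set 'I_n} <- Pi w] = p]
    = [set w | A1 (Pi w)] by apply/seteqP; split => w /= /eqP.
have E2 : [set w | Pi w = p] = [set w | Pi w == p].
  by apply/seteqP; split => w /= /eqP.
rewrite E1 E2; have m1 := mPi A1; have m2 := mPi (eq_op^~ p).
rewrite -[LHS]fineK ?fin_num_measure // -[RHS]fineK ?fin_num_measure //.
congr EFin; rewrite (law A1) (law (eq_op^~ p)).
pose h (v : n.-tuple 'I_n) := [tuple tnth v (s i) | i < n].
pose h' (v : n.-tuple 'I_n) := [tuple tnth v (s^-1%g i) | i < n].
have hK : cancel h h'.
  by move=> v; apply: eq_from_tnth => i; rewrite !tnth_mktuple permKV.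
have h'K : cancel h' h.
  by move=> v; apply: eq_from_tnth => i; rewrite !tnth_mktuple permK.
have hp v : perm_eq (letters (h v)) (letters v).
  by apply: perm_map; apply/tuple_permP; exists s.
rewrite (reindex h) /=; last by apply: onW_bij; exists h'.
have nth_letters (v : n.-tuple 'I_n) (i : 'I_n) :
    nth 0%N (letters v) i = tnth v i.
  by rewrite (nth_map i) ?size_tuple // -tnth_nth.
apply: eq_big => v.
  have -> : packed (letters (h v)) = packed (letters v).
    by rewrite /packed (perm_num_tables (hp v)) (perm_all _ (hp v)).
  congr (_ && (_ == p)).
  rewrite /blocks (perm_num_tables (hp v)) -map_comp; apply: eq_map => x /=.
  apply/setP => i; rewrite -(permKV s i) mem_imset; last exact: perm_inj.
  by rewrite !inE !nth_letters tnth_mktuple.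
move=> _; rewrite /word_weight divff ?gt_eqF // !expr1n !mulr1.
exact: perm_shape_weight.
Qed.

Theorem lemma9 (R : realType) (d : measure_display) (T : measurableType d)
    (P : probability T R) (alpha theta : R) (X Y : nat -> {RV P >-> nat})
    (n : nat) (n_gt0 : (0 < n)%N) :
  0 < alpha -> alpha < 1 -> 0 <= theta ->
  ordered_CRP alpha theta X Y ->
  let Pi := ordered_partition X Y n in
  let one : 'I_n := Ordinal n_gt0 in
  [/\ forall n1 : nat, (0 < n1 <= n)%N ->
        cond_prob P [set w | one \in nth finset.set0 (Pi w) 0]
          [set w | #|nth finset.set0 (Pi w) 0| = n1]
        = block_prob alpha theta n1 (n - n1)%N,
      forall (c : seq nat) (k : nat), is_composition n c -> (k < size c)%N ->
        cond_prob P [set w | one \in nth finset.set0 (Pi w) k]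
          [set w | block_sizes (Pi w) = c]
        = part_prob alpha theta c k
            * \prod_(j < k) (1 - part_prob alpha theta c j)
    & theta = alpha -> exchangeable P Pi /\ size_biased_pick P Pi one].
Proof.
move=> a0 a1 th0 crp Pi one; split.
- exact: cond_prob_leftmost.
- exact: cond_prob_block.
- move=> tha; split=> [|c k cn kc].
    by rewrite tha in crp; exact: (exchangeable_partition n_gt0 a0 crp).
  have [c0 /eqP sumc] := andP cn.
  rewrite (cond_prob_block a0 a1 th0 crp) // tha prod_size_biased ?sumc //.
  by rewrite gt_eqF.
Qed.
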